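(* Let $\sigma$ be a primitive invertible substitution on two letters $\{a,b\}$, with substitution matrix of determinant $1$, with frequency $\alpha$ and dual frequency $\alpha^*$. Let $\alpha'$ be the algebraic conjugate of $\alpha$. The following conditions are equivalent: (1) $\alpha=\alpha^*$; (2) $2\alpha\alpha'=\alpha+\alpha'-1$; (3) there are $k\ge1$ and positive integers $n_1,\dots,n_k$ such that the word $n_1\cdots n_k$ is a palindrome, i.e. $(n_1,\dots,n_k)=(n_k,\dots,n_1)$, and $\alpha=[0;1+n_1,\overline{n_2,\dots,n_k,n_1}]$ or $\alpha=[0;1,\overline{n_1,\dots,n_k}]$.
   Context: A substitution $\sigma$ on $\{a,b\}$ maps each letter to a nonempty finite word over $\{a,b\}$, extended by concatenation. Write $\sigma(j)=\sigma(j)_1\cdots\sigma(j)_{|\sigma(j)|}$, let $|w|_i$ be the number of occurrences of the letter $i$ in $w$, and let $A(w)=(|w|_a,|w|_b)\in\mathbb{Z}^2$. The substitution matrix is $M_\sigma=(|\sigma(j)|_i)_{i,j\in\{a,b\}}$. $\sigma$ is primitive if $M_\sigma^n>0$ entrywise for some $n\in\mathbb{N}$, and invertible if the endomorphism of the free group $F_2=\langle a,b\rangle$ it induces is an automorphism. The frequency of a primitive $\sigma$ is the number $\alpha\in(0,1)$ such that $(1-\alpha,\alpha)^T$ is a (right) eigenvector of $M_\sigma$ for its Perron-Frobenius eigenvalue. Dual substitution: let $(e_a,e_b)$ be the canonical basis of $\mathbb{R}^2$. For $W\in\mathbb{Z}^2$ put $(W,a^* )=\{W+te_b\mid 0\le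 t\le1\}$ and $(W,b^* )=\{W+te_a\mid 0\le t\le1\}$. A finite dual strand is a finite lattice path in $\mathbb{Z}^2$ (vertices joined by unit segments) each of whose steps is $e_a$ or $-e_b$; the dual coding $\psi^*$ sends it to the word obtained by reading the steps in order, writing $b$ for a step $e_a$ and $a$ for a step $-e_b$. Define on formal sums of such segments the linear map $$E_1^*(\sigma)(W,i^* )=\sum_{j,k:\ \sigma(j)_k=i}\Big(M_\sigma^{-1}\big(W+A(\sigma(j)_{k+1}\cdots\sigma(j)_{|\sigma(j)|})\big),j^*\Big).$$ For $\sigma$ primitive and invertible, $E_1^*(\sigma)$ maps finite dual strands to finite dual strands (formal sums being viewed as unions of segments). If $\det M_\sigma=1$, the dual substitution is $\sigma^*(x)=\psi^*(E_1^*(\sigma)(0,x^* ))$ for $x=a,b$, which is again primitive. The dual frequency $\alpha^*$ of $\sigma$ is the frequency of $\sigma^*$. $[0;c_1,c_2,\dots]$ denotes a continued fraction expansion and an overline denotes a period repeated infinitely often. *)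

(* Defs.v *)
From HB Require Import structures.
From mathcomp Require Import all_boot all_order all_algebra.
From mathcomp Require Import freeg complex.
From mathcomp Require Import all_classical all_reals all_analysis.

Set Implicit Arguments.
Unset Strict Implicit.
Unset Printing Implicit Defensive.

Import Order.TTheory GRing.Theory Num.Theory.
Import numFieldNormedType.Exports.
Local Open Scope classical_set_scope.
Local Open Scope ring_scope.

(* The letters a and b are the two elements of 'I_2, so that they directly    *)
(* index the entries of 2 x 2 matrices and of vectors of Z^2.                 *)
Notation letter := 'I_2.
Notation word := (seq letter).
Definition la : letter := ord0.
Definition lb : letter := ord_max.

Definition is_substitution (s : letter -> word) : Prop :=
  forall j, s j != [::].

Definition abelianization (w : word) : 'cV[int]_2 :=
  \col_i (count_mem i w)%:Z.

Definition subst_matrix (s : letter -> word) : 'M[int]_2 :=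
  \matrix_(i, j) (count_mem i (s j))%:Z.

Definition primitive (s : letter -> word) : Prop :=
  exists n : nat, forall i j, 0 < (subst_matrix s ^+ n) i j.

(* F_2 is realized by the reduced words over the signed letters (x, e), where *)
(* (x, false) stands for x and (x, true) for x^-1.                            *)
Definition sletter : Type := (letter * bool)%type.
Definition sinv (x : sletter) : sletter := (x.1, ~~ x.2).

Fixpoint is_reduced (w : seq sletter) : bool :=
  if w is x :: w' then
    (if w' is y :: _ then y != sinv x else true) && is_reduced w'
  else true.

Definition push (x : sletter) (w : seq sletter) : seq sletter :=
  if w is y :: w' then if y == sinv x then w' else x :: w else [:: x].

Definition free_reduce (w : seq sletter) : seq sletter := foldr push [::] w.

Lemma sinvK : involutive sinv.
Proof. by case=> x e; rewrite /sinv /= negbK. Qed.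

Lemma push_reduced x w : is_reduced w -> is_reduced (push x w).
Proof.
case: w => [|y w] //= /andP[yw rw].
by case: eqVneq => //= yx; rewrite yx yw rw.
Qed.

Lemma foldr_push_reduced u v : is_reduced v -> is_reduced (foldr push v u).
Proof. by move=> rv; elim: u => //= x u; apply: push_reduced. Qed.

Lemma free_reduceP w : is_reduced (free_reduce w).
Proof. exact: foldr_push_reduced. Qed.

Lemma free_reduce_id w : is_reduced w -> free_reduce w = w.
Proof.
elim: w => //= x w IH /andP[xw rw]; rewrite /free_reduce /= -/(free_reduce w).
rewrite IH //; case: w xw {IH rw} => //= y w yx.
by rewrite (negPf yx).
Qed.

Lemma pushK x w : is_reduced w -> push x (push (sinv x) w) = w.
Proof.
case: w => [|y w] /=; first by rewrite eqxx.
rewrite sinvK; case: (eqVneq y x) => [->|yx] /=; last by rewrite eqxx.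
by case: w => [|z w] //= /andP[/negPf-> _].
Qed.

Lemma foldr_push_reduce u v :
  is_reduced v -> foldr push v (free_reduce u) = foldr push v u.
Proof.
move=> rv; elim: u => //= x u <-; rewrite /free_reduce /= -/(free_reduce u).
case: (free_reduce u) => [|y w] //=; case: eqVneq => //= ->.
by rewrite pushK // foldr_push_reduced.
Qed.

Lemma free_reduce_cat u v :
  free_reduce (u ++ v) = foldr push (free_reduce v) u.
Proof. exact: foldr_cat. Qed.

Record F2 := MkF2 { F2_word :> seq sletter; F2_wordP : is_reduced F2_word }.
HB.instance Definition _ := [isSub for F2_word].
HB.instance Definition _ := [Choice of F2 by <:].

Definition F2_of_word (w : seq sletter) : F2 := MkF2 (free_reduceP w).
Definition F2_mul (u v : F2) : F2 := F2_of_word (F2_word u ++ F2_word v).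
Definition F2_one : F2 := F2_of_word [::].
Definition F2_inv (u : F2) : F2 := F2_of_word (rev (map sinv (F2_word u))).

Lemma F2_mulA : associative F2_mul.
Proof.
move=> u v w; apply: val_inj => /=.
rewrite [LHS]free_reduce_cat [RHS]free_reduce_cat.
rewrite foldr_push_reduce ?free_reduceP // foldr_cat -(free_reduce_cat v w).
by rewrite [free_reduce (free_reduce _)]free_reduce_id // free_reduceP.
Qed.

Lemma F2_mul1 : left_id F2_one F2_mul.
Proof. by move=> u; apply: val_inj; rewrite /= free_reduce_id // F2_wordP. Qed.

Lemma F2_mulr1 : right_id F2_one F2_mul.
Proof.
by move=> u; apply: val_inj; rewrite /= cats0 free_reduce_id // F2_wordP.
Qed.

Lemma F2_mulV : left_inverse F2_one F2_inv F2_mul.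
Proof.
move=> u; apply: val_inj => /=.
rewrite free_reduce_cat foldr_push_reduce ?free_reduceP // -free_reduce_cat.
elim: (F2_word u) => //= x w IH.
rewrite rev_cons cat_rcons free_reduce_cat -[X in free_reduce (_ :: X)]/(_ :: w).
rewrite [free_reduce _]/= -/(free_reduce w) -{2}(sinvK x).
by rewrite pushK ?free_reduceP // -free_reduce_cat.
Qed.

Lemma F2_mulrV : right_inverse F2_one F2_inv F2_mul.
Proof.
move=> u.
rewrite -[LHS]F2_mul1 -{1}(F2_mulV (F2_inv u)) -F2_mulA.
by rewrite [X in F2_mul _ X]F2_mulA F2_mulV F2_mul1 F2_mulV.
Qed.

HB.instance Definition _ :=
  isGroup.Build F2 F2_mulA F2_mul1 F2_mulr1 F2_mulV F2_mulrV.

Definition F2_gen (x : letter) : F2 := F2_of_word [:: (x, false)].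

Definition F2_positive (w : word) : F2 := (\prod_(x <- w) F2_gen x)%g.

Definition subst_endo (s : letter -> word) (u : F2) : F2 :=
  (\prod_(x <- F2_word u)
     (if x.2 then (F2_positive (s x.1))^-1 else F2_positive (s x.1)))%g.

Lemma subst_endo_morph (s : letter -> word) :
  {morph subst_endo s : u v / (u * v)%g}.
Proof.
pose g (x : sletter) : F2 :=
  (if x.2 then (F2_positive (s x.1))^-1 else F2_positive (s x.1))%g.
pose G w := (\prod_(x <- w) g x)%g.
have gV x : g (sinv x) = ((g x)^-1)%g.
  by case: x => x [] //=; rewrite /g /= invgK.
have Gpush x w : G (push x w) = (g x * G w)%g.
  case: w => [|y w] /=; rewrite /G ?big_cons ?big_nil //.
  by case: eqVneq => [->|_]; rewrite ?big_cons // gV mulVKg.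
have Gred w : G (free_reduce w) = G w.
  by elim: w => // x w IH; rewrite /= Gpush IH /G big_cons.
by move=> u v; rewrite /subst_endo -!/(G _) Gred /G big_cat.
Qed.

Lemma subst_endo_gen (s : letter -> word) (x : letter) :
  subst_endo s (F2_gen x) = F2_positive (s x).
Proof. by rewrite /subst_endo /= big_cons big_nil mulg1. Qed.

Definition invertible (s : letter -> word) : Prop := bijective (subst_endo s).

Definition is_PF_eigenvalue (R : realType) (A : 'M[R]_2) (lam : R) : Prop :=
  eigenvalue A lam /\
  forall mu : R[i], eigenvalue (map_mx (real_complex R) A) mu ->
    mu != lam%:C%C -> `|mu| < lam%:C%C.

Definition freq_vector (R : realType) (alpha : R) : 'cV[R]_2 :=
  \col_i (if i == la then 1 - alpha else alpha).

Definition is_frequency (R : realType) (s : letter -> word) (alpha : R) : Prop :=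
  let M : 'M[R]_2 := map_mx intr (subst_matrix s) in
  0 < alpha < 1 /\
  exists2 lam : R, is_PF_eigenvalue M lam &
    M *m freq_vector alpha = lam *: freq_vector alpha.

Definition vec_a : 'cV[int]_2 := delta_mx la ord0.
Definition vec_b : 'cV[int]_2 := delta_mx lb ord0.

(* (W, a) encodes (W, a^* ) = W + [0,1] e_b and (W, b) encodes                *)
(* (W, b^* ) = W + [0,1] e_a; {freeg segment} is the group of formal sums.    *)
Definition segment : Type := ('cV[int]_2 * letter)%type.

(* A step e_a from V runs through (V, b^* ), a step -e_b from V through       *)
(* (V - e_b, a^* ).                                                           *)
Definition step (i : letter) : 'cV[int]_2 := if i == lb then vec_a else - vec_b.
Definition step_segment (V : 'cV[int]_2) (i : letter) : segment :=
  (if i == lb then V else V - vec_b, i).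

(* The segments, in order, of the dual strand starting at V with coding w.    *)
Fixpoint dual_strand (V : 'cV[int]_2) (w : word) : seq segment :=
  if w is i :: w' then step_segment V i :: dual_strand (V + step i) w'
  else [::].

(* Both kinds of steps increase x - y by 1, so the segments of a dual strand  *)
(* are met in increasing order of the value of x - y at their origin. Reading *)
(* the support of a formal sum in this order defines its coding; dual_codingP *)
(* states that this is psi^* on every finite dual strand.                     *)
Definition origin (e : segment) : 'cV[int]_2 :=
  if e.2 == lb then e.1 else e.1 + vec_b.
Definition height (V : 'cV[int]_2) : int := V la ord0 - V lb ord0.
Definition dual_coding (D : {freeg segment}) : word :=
  [seq e.2 | e <- sort (relpre (height \o origin) <=%O) (dom D)].

Lemma origin_step V i : origin (step_segment V i) = V.
Proof.
by rewrite /origin /step_segment /=; case: (i == lb) => //; rewrite subrK.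
Qed.

Lemma height_step V i : height (V + step i) = height V + 1.
Proof.
rewrite /height /step /vec_a /vec_b; case: (i == lb); rewrite !mxE /=.
  by rewrite addr0 addrAC.
by rewrite oppr0 addr0 opprB addrCA addrC.
Qed.

Lemma dual_strand_sorted V w :
  sorted (relpre (height \o origin) <%O) (dual_strand V w).
Proof.
case: w => //= i w; elim: w V i => //= j w IH V i.
by rewrite !origin_step height_step ltrDl ltr01 /=; exact: IH.
Qed.

Lemma dual_strand_coding V w : [seq e.2 | e <- dual_strand V w] = w.
Proof. by elim: w V => //= i w IH V; rewrite IH. Qed.

Lemma dual_codingP (D : {freeg segment}) V w :
  dom D =i dual_strand V w -> dual_coding D = w.
Proof.
move=> DE; rewrite /dual_coding -[RHS](dual_strand_coding V); congr map.
have srt := dual_strand_sorted V w.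
have srt' : sorted (relpre (height \o origin) <=%O) (dual_strand V w).
  by apply: sub_sorted srt => x y /ltW.
have lt_tr : transitive (relpre (height \o origin) <%O).
  by move=> y x z; apply: lt_trans.
have le_tr : transitive (relpre (height \o origin) <=%O).
  by move=> y x z; apply: le_trans.
have lt_irr : irreflexive (relpre (height \o origin) <%O).
  by move=> x; apply: ltxx.
have inj : {in dual_strand V w &, injective (height \o origin)}.
  move=> x y xw yw xy; have := sorted_ltn_index lt_tr srt.
  case: (ltngtP (index x (dual_strand V w)) (index y (dual_strand V w))).
  - by move=> lxy /(_ _ _ xw yw lxy); rewrite /= [height _]xy ltxx.
  - by move=> lyx /(_ _ _ yw xw lyx); rewrite /= -[height (origin y)]xy ltxx.
  - by move=> /(congr1 (nth x (dual_strand V w))); rewrite !nth_index.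
apply: (sorted_eq_in (leT := relpre (height \o origin) <=%O)).
- by move=> y x z _ _ _; apply: le_tr.
- move=> x y; rewrite !mem_sort !DE => xw yw /le_anti.
  exact: inj.
- by apply: sort_sorted => x y; apply: le_total.
- exact: srt'.
- rewrite perm_sort; apply: uniq_perm => //; first exact: uniq_dom.
  exact: sorted_uniq lt_tr lt_irr _ srt.
Qed.

(* k counts from 0, so drop k.+1 is the suffix after the letter nth _ _ k;     *)
(* invmx is an inverse over int because \det (subst_matrix s) is a unit for   *)
(* the substitutions considered.                                              *)
Definition E1_star_segment (s : letter -> word) (e : segment) : {freeg segment} :=
  \sum_(j : letter) \sum_(k < size (s j) | nth la (s j) k == e.2)
    << (invmx (subst_matrix s) *m (e.1 + abelianization (drop k.+1 (s j))), j) >>.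

Definition E1_star (s : letter -> word) (D : {freeg segment}) : {freeg segment} :=
  fglift (E1_star_segment s) D.

Definition dual_subst (s : letter -> word) (x : letter) : word :=
  dual_coding (E1_star s << (0, x) >>).

Definition is_conjugate (R : realType) (alpha alpha' : R) : Prop :=
  alpha' != alpha /\
  exists p : {poly rat}, [/\ irreducible_poly p,
    root (map_poly ratr p) alpha & root (map_poly ratr p) alpha'].

(* [c 0; c 1, ..., c n] *)
Fixpoint cf_convergent (R : realType) (c : nat -> nat) (n : nat) : R :=
  if n is n'.+1 then (c 0)%:R + (cf_convergent R (fun i => c i.+1) n')^-1
  else (c 0)%:R.

Definition is_cf_expansion (R : realType) (alpha : R) (c : nat -> nat) : Prop :=
  cf_convergent R c n @[n --> \oo] --> alpha.

(* The sequence consisting of pre followed by per repeated infinitely often.  *)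
Definition eventually_periodic (pre per : seq nat) (i : nat) : nat :=
  if (i < size pre)%N then nth 0%N pre i
  else nth 0%N per ((i - size pre) %% size per)%N.

(* Main.v *)
Require Import Defs.
From HB Require Import structures.
From mathcomp Require Import all_boot all_order all_algebra.
From mathcomp Require Import freeg complex.
From mathcomp Require Import all_classical all_reals all_analysis.
From mathcomp Require Import zify ring lra.
Import Order.TTheory GRing.Theory Num.Theory.
Import numFieldNormedType.Exports.
Local Open Scope ring_scope.

Set Implicit Arguments.
Unset Strict Implicit.
Unset Printing Implicit Defensive.

(** Write M = [[p, q], [r, s]] for the substitution matrix.  All three
    conditions are equivalent to the symmetry q = r of M.

    - Condition (1).  In the formal sum E_1^*(sigma)(0, x^* ) the segments of
      type j^* come from the occurrences of x in sigma(j), and they are pairwise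
      distinct, since the suffixes from which they arise have distinct lengths.
      Hence the matrix of sigma^* is the transpose of M ([subst_matrix_dual]).
      If M and its transpose share the eigenvector (1 - alpha, alpha), then
      q = r; conversely a matrix with positive off-diagonal entries has only
      one positive eigenvector up to scaling.

    - Condition (2).  The eigenvector equation makes alpha, hence also alpha',
      a root of the quadratic polynomial
      (- p + q - r + s) X^2 + (p + 2 r - s) X - r, and the relations between its
      roots and its coefficients turn 2 alpha alpha' = alpha + alpha' - 1
      into q = r.

    - Condition (3).  Put x = 1 / alpha - 1; then r x^2 + (s - p) x - q = 0, and
      (3) says that x or 1 / x has a purely periodic continued fraction
      expansion with a palindromic period.  Reversing a finite sequence of
      partial quotients transposes the homography that it defines
      ([cf_eval_rev_moebius]), so a palindromic period makes x a root of an
      equation B x^2 + C x - B = 0 with B != 0; as x is irrational this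
      equation is proportional to the former one and q = r.  Conversely, if M is
      symmetric of determinant 1, multiplying it on both sides by the inverse of
      [[m, 1], [1, 0]], with m the quotient of q by the smaller diagonal entry,
      is one step of a Euclidean algorithm that peels off both ends of a
      palindrome ([symmetric_palindrome]).  The resulting expansion converges to x
      because two steps of a continued fraction halve the distances
      ([cf_convergent_dist]). *)

(** * The matrix of the dual substitution *)

Lemma dom_sum_uniq (K : choiceType) (L : seq K) :
  uniq L -> perm_eq (dom (\sum_(e <- L) << e >> : {freeg K})) L.
Proof.
move=> uL; apply: uniq_perm => //; first exact: uniq_dom.
move=> e; rewrite mem_dom raddf_sum /=.
under eq_bigr do rewrite coeffU mul1r.
have [eL|eL] := boolP (e \in L).
  rewrite (bigD1_seq e) //= eqxx big1 ?addr0 // => f /negPf fe.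
  by rewrite fe.
rewrite big_seq big1 ?eqxx // => f fL.
by case: eqP eL => // <-; rewrite fL.
Qed.

Lemma size_abelianization (w : word) :
  (size w)%:Z = abelianization w la ord0 + abelianization w lb ord0.
Proof.
rewrite !mxE; elim: w => //= x w IH.
rewrite intS IH !PoszD addrACA; congr (_ + _).
by case: x => -[|[|//]].
Qed.

(** The segment that the letter of index [k] (from 0) of [s j] contributes to
    the image under [E1_star s] of a segment with origin [W]. *)
Definition dual_segment (s : letter -> word) (W : 'cV[int]_2) (j : letter)
    (k : nat) : segment :=
  (invmx (subst_matrix s) *m (W + abelianization (drop k.+1 (s j))), j).

(** Each letter [x] of [s i] yields one segment of type [i], and the coding of a
    formal sum only reads its support: no information is lost because these
    segments are pairwise distinct. *)
Lemma count_dual_subst (s : letter -> word) (i x : letter) :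
  subst_matrix s \in unitmx ->
  count_mem i (dual_subst s x) = count_mem x (s i).
Proof.
move=> Mu; rewrite /dual_subst /dual_coding /E1_star liftU scale1r.
pose ks j := [seq k <- iota 0 (size (s j)) | nth la (s j) k == x].
pose L := [seq dual_segment s 0 j k | j <- index_enum 'I_2, k <- ks j].
(* The origins M^-1 A(u) and M^-1 A(v) of two segments of the same type can only
   agree if the suffixes u and v have the same length. *)
have uL : uniq L.
  apply: allpairs_uniq_dep => [|j _|]; first exact: index_enum_uniq.
    by rewrite filter_uniq ?iota_uniq.
  move=> /= _ y /allpairsPdep[j [k [_ kj ->]]].
  move=> /allpairsPdep[j' [k' [_ kj' ->]]] /= [+ jj']; rewrite -{}jj' in kj' * => /(can_inj (mulKVmx Mu)).
  rewrite !add0r => /(congr1 (fun v : 'cV[int]_2 => v la ord0 + v lb ord0)).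
  rewrite -!size_abelianization !size_drop => -[].
  move: kj kj'; rewrite !mem_filter !mem_iota !add0n /=.
  by move=> /andP[_ kj] /andP[_ kj'] ?; congr existT; lia.
have -> : E1_star_segment s (0, x) = \sum_(e <- L) << e >>.
  rewrite big_allpairs_dep; apply: eq_bigr => j _.
  rewrite /ks big_filter /= -(big_mkord (fun k => nth la (s j) k == x)
    (fun k => << dual_segment s 0 j k >>)).
  by rewrite /index_iota subn0.
rewrite count_map count_sort (permP (dom_sum_uniq uL)).
rewrite /L count_flatten -map_comp sumnE big_map (bigD1 i) //= big1 ?addn0.
  rewrite count_map (eq_count (a2 := xpredT)) ?count_predT; last first.
    by move=> k /=; rewrite eqxx.
  by rewrite size_filter -[in RHS](mkseq_nth la (s i)) count_map.
by move=> j /negPf ji; rewrite count_map (eq_count (a2 := xpred0)) ?count_pred0.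
Qed.

Lemma subst_matrix_dual (s : letter -> word) :
  subst_matrix s \in unitmx ->
  subst_matrix (dual_subst s) = (subst_matrix s)^T.
Proof. by move=> Mu; apply/matrixP => i j; rewrite !mxE count_dual_subst. Qed.

(** * Algebraic conjugates *)

Lemma conjugate_root (R : realType) (x x' : R) (q : {poly rat}) :
  is_conjugate x x' -> root (map_poly ratr q) x -> root (map_poly ratr q) x'.
Proof.
move=> [_ [p [pirr px px']]] qx.
have [/dvdpP[d ->]|/negPf npq] := boolP (p %| q).
  by rewrite rmorphM rootM px' orbT.
have /coprimep_root : coprimep (map_poly (ratr : rat -> R) p) (map_poly ratr q).
  by rewrite coprimep_map irreducible_poly_coprime // npq.
by move=> /(_ x px) /negP[].
Qed.

Lemma conjugate_quadratic (R : realType) (x x' : R) (a b c : int) :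
  is_conjugate x x' -> a%:~R + b%:~R * x + c%:~R * x ^+ 2 = 0 ->
  a%:~R + b%:~R * x' + c%:~R * x' ^+ 2 = 0.
Proof.
move=> xx'; pose q : {poly rat} := a%:~R%:P + b%:~R *: 'X + c%:~R *: 'X^2.
have qE y : (map_poly ratr q).[y] = a%:~R + b%:~R * y + c%:~R * y ^+ 2 :> R.
  rewrite /q !rmorphD /= map_polyC !map_polyZ map_polyX map_polyXn /=.
  by rewrite !hornerE !ratr_int.
by move=> /eqP; rewrite -!qE => qx; apply/eqP; exact: conjugate_root xx' qx.
Qed.

(** A number with a conjugate different from itself is irrational. *)
Lemma conjugate_irrational (R : realType) (x x' : R) (a b : int) :
  is_conjugate x x' -> a%:~R + b%:~R * x = 0 -> a = 0 /\ b = 0.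
Proof.
move=> xx' ab; have := @conjugate_quadratic _ _ _ a b 0 xx'.
rewrite !mul0r !addr0 => /(_ ab) ab'.
have b0 : b = 0.
  apply/eqP; rewrite -(intr_eq0 R); case: xx' => + _; rewrite -subr_eq0.
  by move=> /negPf d; rewrite -[_ == 0]orbF -d -mulf_eq0; apply/eqP; lra.
split=> //; apply/eqP; rewrite -(intr_eq0 R).
by move: ab; rewrite b0 mul0r addr0 => /eqP.
Qed.

(** * Continued fraction expansions *)

(** The value of [n_1; n_2, ..., n_k, x], a continued fraction with a real last
    partial quotient; for k = 0 it is x. *)
Fixpoint cf_eval (R : realType) (s : seq nat) (x : R) : R :=
  if s is n :: s' then n%:R + (cf_eval s' x)^-1 else x.

Lemma cf_eval_rcons (R : realType) s n (x : R) :
  cf_eval (rcons s n) x = cf_eval s (n%:R + x^-1).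
Proof. by elim: s => //= m s ->. Qed.

Lemma cf_eval_gt0 (R : realType) s (x : R) : 0 < x -> 0 < cf_eval s x.
Proof.
by move=> x0; elim: s => //= n s IH; rewrite ltr_wpDl // invr_gt0.
Qed.

Lemma cf_convergent_ge1 (R : realType) c n :
  (forall i, 0 < c i)%N -> 1 <= cf_convergent R c n.
Proof.
elim: n c => [|n IH] c c0 /=; first by rewrite ler1n.
rewrite ler_wpDr ?ler1n // invr_ge0.
exact: le_trans ler01 (IH _ (fun i => c0 i.+1)).
Qed.

(** The convergents approach a number [y 0] with complete quotients [y i]
    geometrically: two steps divide the distance by at least 4, of which a
    factor 2 is kept. *)
Lemma cf_convergent_dist (R : realType) (c : nat -> nat) (y : nat -> R) n :
  (forall i, 0 < c i)%N -> (forall i, 0 < y i) ->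
  (forall i, y i = (c i)%:R + (y i.+1)^-1) ->
  `|cf_convergent R c n - y 0%N| <= (2^-1) ^+ n./2.
Proof.
move=> c0 y0 yE.
have y1 i : 1 <= y i.
  by rewrite yE ler_wpDr ?ler1n // invr_ge0 ltW.
elim/ltn_ind: n c y c0 y0 yE y1 => -[|[|n]] IH c y c0 y0 yE y1.
- rewrite /= expr0 [y 0%N]yE opprD addNKr normrN normfV.
  by rewrite invf_le1 ?normr_gt0 ?gt_eqF // ger0_norm // ltW.
- rewrite /= expr0 [y 0%N]yE opprD addrACA subrr add0r.
  have c1 : 1 <= (c 1%N)%:R :> R by rewrite ler1n.
  have : 0 < ((c 1%N)%:R : R)^-1 <= 1.
    by rewrite invr_gt0 invf_le1 ?ltr0n ?c0.
  have : 0 < (y 1%N)^-1 <= 1 by rewrite invr_gt0 invf_le1 ?y0 ?y1.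
  by rewrite ler_norml; lra.
have cc0 i : (0 < c i.+2)%N by [].
have /= := IH n _ (fun i => c i.+2) (fun i => y i.+2) cc0
  (fun i => y0 _) (fun i => yE _) (fun i => y1 _).
move=> /(_ (ltnW (leqnn _))); set t := cf_convergent _ _ _ => tn.
have t1 : 1 <= t by apply: cf_convergent_ge1.
have y2 := y1 2%N; have c1 : 1 <= (c 1%N)%:R :> R by rewrite ler1n.
have ct : 1 <= (c 1%N)%:R * t by nra.
have cy : 1 <= (c 1%N)%:R * y 2%N by nra.
rewrite [y 0%N]yE opprD addrACA subrr add0r [y 1%N]yE.
have -> : ((c 1%N)%:R + t^-1)^-1 - ((c 1%N)%:R + (y 2%N)^-1)^-1 =
    (t - y 2%N) / (((c 1%N)%:R * t + 1) * ((c 1%N)%:R * y 2%N + 1)).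
  by field; do ?[apply/andP; split]; rewrite ?gt_eqF //; lra.
rewrite normf_div [X in _ / X]ger0_norm; last by nra.
rewrite ler_pdivrMr ?exprS; last by nra.
have := exprn_ge0 n./2 (_ : 0 <= 2^-1 :> R); rewrite invr_ge0 ler0n.
move=> /(_ isT).
have : 4 <= ((c 1%N)%:R * t + 1) * ((c 1%N)%:R * y 2%N + 1) by nra.
move: tn; set e := _ ^+ _; set P := _ * _ => tn P4 e0.
apply: le_trans tn _; nra.
Qed.

Lemma cf_convergent_cvg (R : realType) (c : nat -> nat) (y : nat -> R) :
  (forall i, 0 < c i)%N -> (forall i, 0 < y i) ->
  (forall i, y i = (c i)%:R + (y i.+1)^-1) ->
  is_cf_expansion (y 0%N) c.
Proof.
move=> c0 y0 yE; apply/subr_cvg0 => /=.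
apply: norm_cvg0; apply: (squeeze_cvgr (f := fun=> 0)
  (h := fun n : nat => (2^-1 : R) ^+ n./2)).
- by near=> n; rewrite normr_ge0 cf_convergent_dist.
- exact: cvg_cst.
- have h : ((fun n : nat => (2^-1 : R) ^+ n) @ \oo --> (0:R))%classic.
    by apply: cvg_expr; rewrite ger0_norm; lra.
  apply: cvg_comp h; apply/cvgnyPge => A; near=> n.
  by rewrite geq_half_double; near: n; exact: nbhs_infty_ge.
Unshelve. all: by end_near. Qed.

Lemma cf_expansion_cons (R : realType) (c : nat -> nat) (x : R) :
  x != 0 -> is_cf_expansion x (fun i => c i.+1) ->
  is_cf_expansion ((c 0%N)%:R + x^-1) c.
Proof.
move=> x0 cx; rewrite /is_cf_expansion -cvg_shiftS.
by apply: cvgD; [exact: cvg_cst | exact: cvgV].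
Qed.

(** The tail of a continued fraction expansion converges: its convergents are at
    most [c 1 + 1], which keeps their inverses away from 0. *)
Lemma cf_expansion_uncons (R : realType) (c : nat -> nat) (x : R) :
  (forall i, 0 < c i.+1)%N -> is_cf_expansion x c ->
  exists y : R,
    [/\ 1 <= y, x = (c 0%N)%:R + y^-1 & is_cf_expansion y (fun i => c i.+1)].
Proof.
move=> c0 cx; pose u n := cf_convergent R (fun i => c i.+1) n.
have u1 n : 1 <= u n by apply: cf_convergent_ge1.
have uV : (((u n)^-1) @[n --> \oo] --> x - (c 0%N)%:R)%classic.
  rewrite (_ : (fun n => _) = (fun n => cf_convergent R c n.+1 - (c 0%N)%:R)).
    by apply: cvgB; [rewrite cvg_shiftS | exact: cvg_cst].
  by apply/funext => n /=; rewrite addrC addKr.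
have ub n : u n <= (c 1%N)%:R + 1.
  case: n => [|n]; rewrite /u /=; first by rewrite lerDl.
  have cc0 i : (0 < c i.+2)%N by [].
  have := cf_convergent_ge1 R n cc0; set v := cf_convergent _ _ _ => v1.
  by rewrite lerD2l invf_le1 //; lra.
have xgt : 0 < x - (c 0%N)%:R.
  apply: (@lt_le_trans _ _ ((c 1%N)%:R + 1)^-1).
    by rewrite invr_gt0 ltr_wpDl.
  rewrite -(cvg_lim _ uV) //; apply: limr_ge.
    by apply/cvg_ex; eexists; exact: uV.
  near=> n; rewrite lef_pV2 ?posrE ?ltr_wpDl //.
  by have := u1 n; lra.
have uc : (u n @[n --> \oo] --> (x - (c 0%N)%:R)^-1)%classic.
  rewrite (_ : u = fun n => ((u n)^-1)^-1); last first.
    by apply/funext => n; rewrite invrK.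
  by apply: cvgV => //; rewrite gt_eqF.
exists (x - (c 0%N)%:R)^-1; split=> //; last by rewrite invrK addrC subrK.
rewrite -(cvg_lim _ uc) //; apply: limr_ge.
  by apply/cvg_ex; eexists; exact: uc.
by near=> n.
Unshelve. all: by end_near. Qed.

(** Changing the first partial quotient by [a] translates the limit by [a]. *)
Lemma cf_expansion_shift0 (R : realType) (c d : nat -> nat) (x a : R) :
  (forall i, d i.+1 = c i.+1) -> (d 0%N)%:R = (c 0%N)%:R + a ->
  is_cf_expansion x c -> is_cf_expansion (x + a) d.
Proof.
move=> dc d0 cx; rewrite /is_cf_expansion.
rewrite (_ : (fun n => _) = fun n => cf_convergent R c n + a); last first.
  apply/funext => -[|n] //=; rewrite d0 addrAC; congr (_ + _^-1 + _).
  by congr cf_convergent; apply/funext.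
by apply: cvgD cx _; exact: cvg_cst.
Qed.

Lemma cf_expansion_iter (R : realType) (c : nat -> nat) (x : R) m :
  (forall i, 0 < c i)%N -> is_cf_expansion x c ->
  exists2 y : R, x = cf_eval (mkseq c m) y &
    is_cf_expansion y (fun i => c (m + i)%N).
Proof.
elim: m c x => [|m IH] c x c0 cx; first by exists x.
have c0' i : (0 < c i.+1)%N by [].
have [z [z1 -> cz]] := cf_expansion_uncons c0' cx.
have [y -> cy] := IH _ _ c0' cz; exists y => //.
by rewrite /mkseq /= (iotaDl 1 0) -map_comp.
Qed.

(** * Purely periodic and palindromic expansions *)

Lemma periodic_expansion_fixed (R : realType) n (x : R) :
  (0 < size n)%N -> all (fun m => 0 < m)%N n ->
  is_cf_expansion x (eventually_periodic [::] n) -> 0 < x /\ cf_eval n x = x.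
Proof.
move=> n0 np cx; set c := eventually_periodic _ _ in cx.
have cE i : c i = nth 0%N n (i %% size n).
  by rewrite /c /eventually_periodic subn0.
have c0 i : (0 < c i)%N.
  by rewrite cE; apply: (allP np); rewrite mem_nth // ltn_mod.
split.
  have c0' i : (0 < c i.+1)%N by [].
  have [y [y1 -> _]] := cf_expansion_uncons c0' cx.
  by rewrite ltr_wpDl // invr_gt0; lra.
have [y xy cy] := cf_expansion_iter (size n) c0 cx.
have yx : y = x.
  apply: cvg_unique cy _; first exact: norm_hausdorff.
  rewrite (_ : (fun i => c (size n + i)%N) = c) //.
  by apply/funext => i; rewrite !cE modnDl.
rewrite [RHS]xy yx; congr cf_eval.
apply: (@eq_from_nth _ 0%N); rewrite ?size_mkseq //.
by move=> i ni; rewrite nth_mkseq // cE modn_small.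
Qed.

Lemma fixed_periodic_expansion (R : realType) n (x : R) :
  (0 < size n)%N -> all (fun m => 0 < m)%N n -> 0 < x -> cf_eval n x = x ->
  is_cf_expansion x (eventually_periodic [::] n).
Proof.
move=> n0 np x0 nx; set c := eventually_periodic _ _.
have cE i : c i = nth 0%N n (i %% size n).
  by rewrite /c /eventually_periodic subn0.
(* The complete quotients of x, indexed by the position in the period. *)
pose y i := cf_eval (drop (i %% size n) n) x.
have <- : y 0%N = x by rewrite /y mod0n drop0.
apply: cf_convergent_cvg => i.
- by rewrite cE; apply: (allP np); rewrite mem_nth // ltn_mod.
- exact: cf_eval_gt0.
rewrite cE /y -addn1 -modnDml; have := ltn_pmod i n0; set j := (i %% _)%N => jn.
rewrite (drop_nth 0%N) //=; congr (_ + _^-1); rewrite addn1.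
have [jn'|jn'] := ltnP j.+1 (size n); first by rewrite modn_small.
have -> : j.+1 = size n by apply/eqP; rewrite eqn_leq jn.
by rewrite modnn drop0 nx drop_size.
Qed.

Lemma eventually_periodic_rot m n i : (0 < size n)%N ->
  eventually_periodic [:: m] (rot 1 n) i.+1 = eventually_periodic [::] n i.+1.
Proof.
case: n => // a n _; rewrite /eventually_periodic /= rot1_cons size_rcons.
rewrite subn1 /= subn0.
rewrite nth_rcons -[i.+1]addn1 -modnDml; have := ltn_pmod i (ltn0Sn (size n)).
set j := (i %% _)%N; rewrite ltnS leq_eqVlt => /predU1P[->|jn].
  by rewrite ltnn eqxx addn1 modnn.
by rewrite jn modn_small addn1.
Qed.

(** The homography of a sequence of partial quotients is the product of the
    symmetric matrices [[n_i, 1], [1, 0]], so that reversing the sequence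
    transposes its matrix. *)
Lemma cf_eval_rev_moebius (R : realType) (s : seq nat) :
  (0 < size s)%N -> all (fun m => 0 < m)%N s ->
  exists A B C D : nat, [/\ (0 < A)%N, (0 < B)%N, (0 < C)%N &
   forall x : R, 0 < x ->
     cf_eval s x = (A%:R * x + B%:R) / (C%:R * x + D%:R) /\
     cf_eval (rev s) x = (A%:R * x + C%:R) / (B%:R * x + D%:R)].
Proof.
elim: s => // n s IH _ /= /andP[n0 s0].
case: (posnP (size s)) => [/size0nil->|sz].
  exists n, 1%N, 1%N, 0%N; split=> // x x0; rewrite /= !mul1r addr0.
  by split; field; rewrite gt_eqF.
have [A [B [C [D [A0 B0 C0 H]]]]] := IH sz s0.
exists (n * A + C)%N, (n * B + D)%N, A, B.
split; rewrite // ?addn_gt0 ?muln_gt0 ?n0 ?A0 ?B0 //.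
move=> x x0; have [-> _] := H x x0.
have /H[_] : 0 < n%:R + x^-1 by rewrite ltr_wpDl // invr_gt0.
rewrite rev_cons cf_eval_rcons => ->.
have [A1 B1 C1 D1] : [/\ 0 < A%:R :> R, 0 < B%:R :> R, 0 < C%:R :> R &
    0 <= D%:R :> R].
  by rewrite !ltr0n.
have n1 : 0 < n%:R :> R by rewrite ltr0n.
have nx : 0 < (n%:R * B%:R + D%:R) * x.
  by rewrite mulr_gt0 // ltr_wpDr ?mulr_gt0.
rewrite !natrD !natrM.
by split; field; do ?[apply/andP; split]; rewrite ?gt_eqF //; nra.
Qed.

Lemma palindrome_fixed_point (R : realType) (n : seq nat) (x : R) :
  (0 < size n)%N -> all (fun m => 0 < m)%N n -> n = rev n ->
  0 < x -> cf_eval n x = x ->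
  exists B C : int, B != 0 /\ B%:~R * x ^+ 2 + C%:~R * x - B%:~R = 0.
Proof.
move=> n0 np nr x0 nx.
have [A [B [C [D [A0 B0 C0 H]]]]] := cf_eval_rev_moebius R n0 np.
have [] := H x x0; rewrite -nr nx.
have [A1 B1 C1 D1] : [/\ 0 < A%:R :> R, 0 < B%:R :> R, 0 < C%:R :> R &
    0 <= D%:R :> R].
  by rewrite !ltr0n.
have d1 : C%:R * x + D%:R != 0 :> R by rewrite gt_eqF // ltr_wpDr ?mulr_gt0.
have d2 : B%:R * x + D%:R != 0 :> R by rewrite gt_eqF // ltr_wpDr ?mulr_gt0.
move=> /(congr1 (fun z => z * (C%:R * x + D%:R))); rewrite divfK // => e1.
move=> /(congr1 (fun z => z * (B%:R * x + D%:R))); rewrite divfK // => e2.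
(* x is fixed by a homography and by its transpose. *)
have BC : B%:R = C%:R :> R.
  have : (C%:R - B%:R) * (x ^+ 2 + 1) = 0 :> R by lra.
  by move=> /eqP; rewrite mulf_eq0 => /orP[/eqP|/eqP]; [lra|nra].
exists B%:Z, (D%:Z - A%:Z); split; first by rewrite -lt0n in B0 *.
by rewrite rmorphB /= -!pmulrn; lra.
Qed.

(** A symmetric matrix [[p, q], [q, s]] of determinant 1 whose smallest entry is
    s > 0 is the homography of a palindrome.  With q = m s + q' and 0 <= q' < s
    it equals E [[s, q'], [q', t]] E, where E = [[m, 1], [1, 0]]; the middle
    factor is again of this form, or the identity if q' = 0. *)
Lemma symmetric_palindrome (p q s : nat) :
  (p * s = q ^ 2 + 1)%N -> (s <= q)%N ->
  exists n : seq nat, [/\ (0 < size n)%N, all (fun m => 0 < m)%N n, n = rev n &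
    forall (R : realType) (x : R), 0 < x ->
      cf_eval n x = (p%:R * x + q%:R) / (q%:R * x + s%:R)].
Proof.
elim/ltn_ind: q p s => q IH p s det sq.
have s0 : (0 < s)%N by case: s det {sq} => //; rewrite muln0 addn1.
have [m [q' [q's qE]]] : exists m q', (q' < s)%N /\ q = (m * s + q')%N.
  by exists (q %/ s)%N, (q %% s)%N; rewrite ltn_mod -divn_eq.
have m0 : (0 < m)%N by case: m qE => // qE; lia.
have [q'0|q'0] := posnP q'.
  have qm : q = (m * s)%N by rewrite qE q'0 addn0.
  have s1 : s = 1%N.
    apply/eqP; rewrite -dvdn1 -(dvdn_addr (m := q ^ 2)); last first.
      by rewrite qm expnMn dvdn_mull // dvdn_exp.
    by rewrite -det dvdn_mull.
  have pE : p = (m * m + 1)%N by move: det; rewrite qm s1; lia.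
  exists [:: m; m]; split; rewrite //= ?m0 // => R x x0.
  rewrite pE qE q'0 s1 !natrD !natrM /= addr0.
  have m1 : 0 < m%:R :> R by rewrite ltr0n.
  by field; do ?[apply/andP; split]; rewrite ?gt_eqF //; nra.
have [t pE] : exists t, (p = t + 2 * m * q' + m * m * s)%N.
  exists (p - (2 * m * q' + m * m * s))%N; rewrite -addnA subnK //.
  by rewrite -(leq_pmul2r s0) det qE; nia.
have det' : (s * t = q' ^ 2 + 1)%N by move: det; rewrite pE qE; nia.
have [||n [n0 np nr nE]] := IH q' _ s t det'.
- by rewrite (leq_trans q's).
- have h : (q' * q' <= s * q')%N by rewrite leq_mul2r ltnW ?orbT.
  by rewrite -ltnS -(ltn_pmul2l s0) det' mulnS -mulnn; lia.
exists (m :: rcons n m); split.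
- by [].
- by rewrite /= all_rcons m0.
- by rewrite rev_cons rev_rcons -nr.
move=> R x x0; rewrite /= cf_eval_rcons nE; last first.
  by rewrite ltr_wpDl // invr_gt0.
have m1 : 0 < m%:R :> R by rewrite ltr0n.
have q1 : 0 < q'%:R :> R by rewrite ltr0n.
have s1 : 0 < s%:R :> R by rewrite ltr0n.
have mx0 : 0 < m%:R * x + 1 by rewrite ltr_wpDr ?mulr_gt0.
have t0 : 0 <= t%:R :> R by [].
rewrite pE qE !natrD !natrM.
by field; do ?[apply/andP; split]; rewrite ?gt_eqF //; nra.
Qed.

Lemma eventually_periodic_gt0 pre per i :
  (0 < size per)%N -> all (fun m => 0 < m)%N pre ->
  all (fun m => 0 < m)%N per ->
  (0 < eventually_periodic pre per i)%N.
Proof.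
move=> per0 pre_gt0 per_gt0; rewrite /eventually_periodic.
case: (ltnP i (size pre)) => ilt.
  by apply: (allP pre_gt0); rewrite mem_nth.
by apply: (allP per_gt0); rewrite mem_nth // ltn_mod.
Qed.

(** Condition (3): with x = 1 / alpha - 1, the first form of the expansion says
    that x is the purely periodic continued fraction of period n, the second
    one that 1 / x is. *)
Definition palindromic_expansion (R : realType) (alpha : R) : Prop :=
  exists n : seq nat,
    [/\ (0 < size n)%N, all (fun m => 0 < m)%N n, n = rev n &
        is_cf_expansion alpha
          (eventually_periodic [:: 0%N; (1 + head 0%N n)%N] (rot 1 n)) \/
        is_cf_expansion alpha (eventually_periodic [:: 0%N; 1%N] n)].

Lemma head_periodic n :
  eventually_periodic [::] n 0 = head 0%N n.
Proof. by rewrite /eventually_periodic /= mod0n nth0. Qed.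

Lemma palindromic_expansion_quadratic (R : realType) (alpha : R) :
  palindromic_expansion alpha ->
  exists B C : int, B != 0 /\
    B%:~R * (alpha^-1 - 1) ^+ 2 + C%:~R * (alpha^-1 - 1) - B%:~R = 0.
Proof.
case=> n [n0 np nr [cfa|cfa]].
  have c0 i : (0 < eventually_periodic [:: (1 + head 0%N n)%N] (rot 1 n) i)%N.
    by rewrite eventually_periodic_gt0 ?size_rot // (eq_all_r (mem_rot 1 n)).
  (* Here x = 1 / alpha = [1 + n_1; n_2, ..., n_k, n_1, ...]. *)
  have [x [_ + cx]] := cf_expansion_uncons c0 cfa.
  rewrite add0r => ->; rewrite invrK.
  have [|x0 nx] := @periodic_expansion_fixed _ n (x - 1) n0 np; last first.
    exact: palindrome_fixed_point n0 np nr x0 nx.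
  apply: cf_expansion_shift0 cx => [i|].
    exact/esym/eventually_periodic_rot.
  by rewrite head_periodic natrD addrAC subrr add0r.
have c0 i : (0 < eventually_periodic [:: 1%N] n i)%N.
  by rewrite eventually_periodic_gt0.
(* Here x = 1 / alpha = 1 + 1 / y with y purely periodic. *)
have [x [_ + cx]] := cf_expansion_uncons c0 cfa.
rewrite add0r => ->; rewrite invrK.
have c1 i : (0 < eventually_periodic [::] n i)%N.
  by rewrite eventually_periodic_gt0.
have [y [y1 xE cy]] := cf_expansion_uncons c1 cx.
have -> : x = 1 + y^-1 by [].
have [y0 ny] := periodic_expansion_fixed n0 np cy.
have [B [C [B0 E]]] := palindrome_fixed_point n0 np nr y0 ny.
exists B, (- C); split=> //; rewrite [1 + _]addrC addrK rmorphN /=.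
apply: (mulfI (_ : y ^+ 2 != 0)); first by rewrite sqrf_eq0 gt_eqF.
by rewrite mulr0 -[RHS]oppr0 -E; field; rewrite gt_eqF.
Qed.

(** By [symmetric_palindrome], x = 1 / alpha - 1 is purely periodic if s <= q;
    otherwise p <= q, and exchanging the two coordinates replaces x by 1 / x. *)
Lemma symmetric_palindromic_expansion (R : realType) (p q s : nat) (alpha : R) :
  (p * s = q ^ 2 + 1)%N -> (0 < q)%N -> 0 < alpha < 1 ->
  q%:R * (alpha^-1 - 1) ^+ 2 + (s%:R - p%:R) * (alpha^-1 - 1) - q%:R = 0 ->
  palindromic_expansion alpha.
Proof.
move=> det q0 /andP[a0 a1]; set x := _^-1 - 1 => E.
have x0 : 0 < x by rewrite subr_gt0 invf_gt1.
have q1 : 0 < q%:R :> R by rewrite ltr0n.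
have [sq|qs] := leqP s q.
  have [n [n0 np nr nE]] := symmetric_palindrome det sq.
  exists n; split=> //; left.
  have nx : cf_eval n x = x.
    rewrite nE //; apply: (canLR (mulfK _)).
      by rewrite gt_eqF ?ltr_wpDr ?mulr_gt0.
    by lra.
  have cx := fixed_periodic_expansion n0 np x0 nx.
  have -> : alpha = 0%:R + (x + 1)^-1 by rewrite add0r /x subrK invrK.
  apply: cf_expansion_cons; first by rewrite gt_eqF // addr_gt0.
  apply: cf_expansion_shift0 cx => [i|]; first exact: eventually_periodic_rot.
  by rewrite head_periodic addrC natrD.
have pq : (p <= q)%N.
  by rewrite leqNgt; apply/negP => qp; have := leq_mul qp qs; nia.
have [|n [n0 np nr nE]] := @symmetric_palindrome s q p _ pq.
  by rewrite mulnC.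
exists n; split=> //; right.
have y0 : 0 < x^-1 by rewrite invr_gt0.
have ny : cf_eval n x^-1 = x^-1.
  rewrite nE //; apply: (canLR (mulfK _)).
    by rewrite gt_eqF ?ltr_wpDr ?mulr_gt0.
  apply: (mulfI (_ : x ^+ 2 != 0)); first by rewrite sqrf_eq0 gt_eqF.
  by apply/eqP; rewrite -subr_eq0 -E; apply/eqP; field; rewrite gt_eqF.
have cy := fixed_periodic_expansion n0 np y0 ny.
have -> : alpha = 0%:R + (1%:R + (x^-1)^-1)^-1.
  by rewrite add0r invrK /x addrC subrK invrK.
apply: cf_expansion_cons; first by rewrite gt_eqF // addr_gt0 ?invr_gt0.
apply: (@cf_expansion_cons _ (eventually_periodic [:: 1%N] n)) => //.
by rewrite gt_eqF.
Qed.

(** * Substitution matrices and frequencies *)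

(** A triangular matrix has triangular powers, hence is not primitive. *)
Lemma primitive_offdiag (s : letter -> word) (i j : letter) :
  primitive s -> i != j -> (0 < count_mem i (s j))%N.
Proof.
case=> n /(_ i j) Mn ij; rewrite lt0n; apply/negP => /eqP Mij.
suff M0 m : (subst_matrix s ^+ m) i j = 0 by rewrite M0 in Mn.
elim: m => [|m IH]; first by rewrite expr0 mxE (negPf ij).
rewrite exprS -mulmxE mxE big1 // => k _.
have [->|kj] := eqVneq k j; first by rewrite mxE Mij mul0r.
suff -> : k = i by rewrite IH mulr0.
apply/val_inj; move: i j k ij kj {Mn Mij IH}.
by move=> [[|[|//]] ?] [[|[|//]] ?] [[|[|//]] ?].
Qed.

Lemma frequency_eigen (R : realType) (s : letter -> word) (alpha : R) :
  is_frequency s alpha -> 0 < alpha < 1 /\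
  exists lam : R, let M i j : R := (subst_matrix s i j)%:~R in
    M la la * (1 - alpha) + M la lb * alpha = lam * (1 - alpha) /\
    M lb la * (1 - alpha) + M lb lb * alpha = lam * alpha.
Proof.
case=> a01 [lam _ E]; split=> //; exists lam => /=.
have {}E i := congr1 (fun v : 'cV[R]_2 => v i ord0) E.
move: (E la) (E lb); rewrite !mxE !big_ord_recl !big_ord0 !mxE /= !addr0.
by have -> : fintype.lift ord0 ord0 = lb by exact/val_inj.
Qed.

Lemma det_mx22 (R : comPzRingType) (A : 'M[R]_2) :
  \det A = A la la * A lb lb - A la lb * A lb la.
Proof.
rewrite (expand_det_row _ la) !big_ord_recl big_ord0 addr0 /cofactor.
rewrite !det_mx11 !mxE /=.
rewrite !addn0 addn1 expr0 expr1 mul1r mulN1r mulrN.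
by congr (A _ _ * A _ _ - A _ _ * A _ _); exact/val_inj.
Qed.

(** * The equivalence of the three conditions *)

Theorem theorem6p7 (R : realType) (sigma : letter -> word)
    (alpha alpha_star alpha' : R)
    (hsubst : is_substitution sigma)
    (hprim : primitive sigma)
    (hinv : invertible sigma)
    (hdet : \det (subst_matrix sigma) = 1)
    (halpha : is_frequency sigma alpha)
    (halpha_star : is_frequency (dual_subst sigma) alpha_star)
    (halpha' : is_conjugate alpha alpha') :
  let palindromic_expansion :=
    exists n : seq nat,
      [/\ (0 < size n)%N, all (fun m => 0 < m)%N n, n = rev n &
          is_cf_expansion alpha
            (eventually_periodic [:: 0%N; (1 + head 0%N n)%N] (rot 1 n)) \/
          is_cf_expansion alpha (eventually_periodic [:: 0%N; 1%N] n)] in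
  (alpha = alpha_star <-> 2 * alpha * alpha' = alpha + alpha' - 1) /\
  (2 * alpha * alpha' = alpha + alpha' - 1 <-> palindromic_expansion).
Proof.
move=> pal; rewrite {}/pal -/(palindromic_expansion alpha).
have q0 : (0 < count_mem la (sigma lb))%N by exact: primitive_offdiag.
have r0 : (0 < count_mem lb (sigma la))%N by exact: primitive_offdiag.
have Mu : subst_matrix sigma \in unitmx by rewrite unitmxE hdet unitr1.
have [a01 [lam]] := frequency_eigen halpha.
have [b01 [mu]] := frequency_eigen halpha_star.
move: hdet; rewrite (subst_matrix_dual Mu) det_mx22 /= !mxE.
move: q0 r0; set p := count_mem la (sigma la); set q := count_mem la (sigma lb).
set r := count_mem lb (sigma la); set s := count_mem lb (sigma lb).
rewrite -!pmulrn => q0 r0 det [b1 b2] [a1 a2].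
have [q1 r1] : 0 < q%:R :> R /\ 0 < r%:R :> R by rewrite !ltr0n.
have := a01 => /andP[a_gt0 a_lt1]; have := b01 => /andP[b_gt0 b_lt1].
have aE : - r%:R + (p%:R + 2 * r%:R - s%:R) * alpha +
    (- p%:R + q%:R - r%:R + s%:R) * alpha ^+ 2 = 0.
  have : lam * (1 - alpha) * alpha = lam * alpha * (1 - alpha) by ring.
  by rewrite -a1 -a2; lra.
have a'E : - r%:R + (p%:R + 2 * r%:R - s%:R) * alpha' +
    (- p%:R + q%:R - r%:R + s%:R) * alpha' ^+ 2 = 0.
  have := @conjugate_quadratic _ _ _ (- r%:Z) (p%:Z + 2 * r%:Z - s%:Z)
    (- p%:Z + q%:Z - r%:Z + s%:Z) halpha'.
  by rewrite !(rmorphD, rmorphN, rmorphM) /= -!pmulrn; exact.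
have aN : alpha' - alpha != 0 by rewrite subr_eq0; case: halpha'.
(* Sum and product of the roots of D X^2 + E X - r. *)
pose D : R := - p%:R + q%:R - r%:R + s%:R.
pose E : R := p%:R + 2 * r%:R - s%:R.
have sumE : D * (alpha + alpha') = - E.
  by apply: (mulfI aN); rewrite /D /E; lra.
have prodE : D * (alpha * alpha') = - r%:R.
  have : alpha * (D * (alpha + alpha')) = alpha * - E by rewrite sumE.
  by rewrite /D /E; lra.
(* Otherwise r = 0 by the product formula. *)
have D0 : D != 0.
  by apply/eqP => D0; move: prodE; rewrite D0 mul0r; lra.
have cond1 : alpha = alpha_star <-> q = r.
  split=> [ab|qr].
    apply/eqP; rewrite -(eqr_nat R); apply/eqP.
    (* Subtract the eigenvector equations of M and of its transpose, and
       eliminate the difference of the two eigenvalues. *)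
    have : (q%:R - r%:R) * (alpha ^+ 2 + (1 - alpha) ^+ 2) = 0.
      rewrite -ab in b1 b2.
      have -> : (q%:R - r%:R) * (alpha ^+ 2 + (1 - alpha) ^+ 2) =
        alpha * ((p%:R * (1 - alpha) + q%:R * alpha) -
                 (p%:R * (1 - alpha) + r%:R * alpha)) -
        (1 - alpha) * ((r%:R * (1 - alpha) + s%:R * alpha) -
                       (q%:R * (1 - alpha) + s%:R * alpha)) by ring.
      by rewrite a1 a2 b1 b2; ring.
    move=> /eqP; rewrite mulf_eq0 => /orP[/eqP|/eqP]; first lra.
    by have := sqr_ge0 (1 - alpha); nra.
  have bE : - r%:R + (p%:R + 2 * r%:R - s%:R) * alpha_star +
      (- p%:R + q%:R - r%:R + s%:R) * alpha_star ^+ 2 = 0.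
    have : mu * (1 - alpha_star) * alpha_star =
           mu * alpha_star * (1 - alpha_star).
      by ring.
    by rewrite -b1 -b2 qr; lra.
  (* Both frequencies solve the same equation; the second factor below is
     positive. *)
  apply/eqP; rewrite -subr_eq0.
  have : (alpha - alpha_star) * (r%:R * (1 - alpha) * (1 - alpha_star) +
    q%:R * alpha * alpha_star) = 0.
    have : alpha * (1 - alpha) *
        (- r%:R + (p%:R + 2 * r%:R - s%:R) * alpha_star +
         (- p%:R + q%:R - r%:R + s%:R) * alpha_star ^+ 2) -
      alpha_star * (1 - alpha_star) *
        (- r%:R + (p%:R + 2 * r%:R - s%:R) * alpha +
         (- p%:R + q%:R - r%:R + s%:R) * alpha ^+ 2) = 0.
      by rewrite aE bE; ring.
    by lra.
  move=> /eqP; rewrite mulf_eq0 => /orP[//|].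
  by rewrite gt_eqF // addr_gt0 // !mulr_gt0 // subr_gt0.
have cond2 : 2 * alpha * alpha' = alpha + alpha' - 1 <-> q = r.
  have -> : (2 * alpha * alpha' = alpha + alpha' - 1) <-> (q%:R = r%:R :> R).
    split=> [h|qr].
      have : D * (2 * alpha * alpha') = D * (alpha + alpha' - 1) by rewrite h.
      by rewrite mulrBr sumE -mulrA mulrCA prodE /D /E; lra.
    by apply: (mulfI D0); rewrite mulrBr sumE -mulrA mulrCA prodE /D /E; lra.
  by split=> [/eqP|->//]; rewrite eqr_nat => /eqP.
have xE : r%:R * (alpha^-1 - 1) ^+ 2 + (s%:R - p%:R) * (alpha^-1 - 1) -
    q%:R = 0.
  have -> : r%:R * (alpha^-1 - 1) ^+ 2 + (s%:R - p%:R) * (alpha^-1 - 1) - q%:R =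
    - (- r%:R + (p%:R + 2 * r%:R - s%:R) * alpha +
    (- p%:R + q%:R - r%:R + s%:R) * alpha ^+ 2) / alpha ^+ 2 :> R.
    by field; rewrite gt_eqF.
  by rewrite aE oppr0 mul0r.
have cond3 : palindromic_expansion alpha <-> q = r.
  split=> [/palindromic_expansion_quadratic[B [C [B0 BE]]]|qr].
    (* Eliminating x^2 between the two equations of x = 1 / alpha - 1 leaves
       K x + L = 0, and alpha is irrational. *)
    pose K := B * (s%:Z - p%:Z) - r%:Z * C; pose L := B * (r%:Z - q%:Z).
    have [K0] : K = 0 /\ L - K = 0.
      apply: (conjugate_irrational halpha').
      have : alpha * (B%:~R * (r%:R * (alpha^-1 - 1) ^+ 2 +
          (s%:R - p%:R) * (alpha^-1 - 1) - q%:R) -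
        r%:R * (B%:~R * (alpha^-1 - 1) ^+ 2 +
          C%:~R * (alpha^-1 - 1) - B%:~R)) = 0.
        by rewrite xE BE; ring.
      move=> <-; rewrite /L /K !(rmorphB, rmorphM) /= -!pmulrn.
      by field; rewrite gt_eqF.
    rewrite K0 subr0 => /eqP; rewrite mulf_eq0 (negPf B0) subr_eq0 /=.
    by move=> /eqP[->].
  move: xE; rewrite -qr; apply: symmetric_palindromic_expansion => //.
  by move: det; rewrite -qr; lia.
by rewrite cond1 cond2 cond3.
Qed.
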